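(* Assume that $$\int_0^{+\infty}\lambda(t)\,dt=+\infty\quad\text{and}\quad \int_0^{+\infty}|\lambda'(t)|\,dt<+\infty,$$ and additionally assume that one of the two following assumptions holds: (1) The set $Q$ is symmetric with respect to the origin and $f$ is even on $Q$ (i.e. for all $x\in Q$, $-x\in Q$ and $f(-x)=f(x)$). (2) The set $\arg\min_Q f$ has an interior point $x_0^*$ in $\mathcal{H}$. Then for any $x_0\in Q$ the solution $x\in C^1([0,+\infty),\mathcal{H})$ of $$x'(t)+x(t)=P_Q\big(x(t)-\lambda(t)\nabla f(x(t))\big),\quad t\ge 0,\qquad x(0)=x_0,$$ converges strongly in $\mathcal{H}$ as $t\to+\infty$ to some $x^*\in\arg\min_Q f$.
   Context: $\mathcal{H}$ is a real Hilbert space with inner product $\langle\cdot,\cdot\rangle$ and norm $\|\cdot\|$. $Q$ is a closed, convex, non-empty subset of $\mathcal{H}$, and $P_Q:\mathcal{H}\to Q$ is the (metric) projection onto $Q$. $\lambda:[0,+\infty)\to(0,+\infty)$ is an absolutely continuous function belonging to $W^{1,1}_{loc}([0,+\infty))$ (that is, absolutely continuous on each $[0,T]$). $f:\mathcal{H}\to\mathbb{R}$ is a $C^1$ convex function whose gradient $\nabla f$ is locally Lipschitz on $\mathcal{H}$. It is assumed that $f$ attains its minimum over $Q$: with $f_Q^*:=\min_Q f$, the set $\arg\min_Q f:=\{x\in Q: f(x)=f_Q^*\}$ is non-empty. Under these standing assumptions, for every $x_0\in Q$ the Cauchy problem $x'(t)+x(t)=P_Q\big(x(t)-\lambda(t)\nabla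 f(x(t))\big)$, $t\ge 0$, $x(0)=x_0$, has a unique global solution $x\in C^1([0,+\infty),\mathcal{H})$, and it stays in $Q$. *)

(* Defs.v *)
From HB Require Import structures.
From mathcomp Require Import all_boot all_order all_algebra.
From mathcomp Require Import sesquilinear.
From mathcomp Require Import all_classical all_reals all_analysis.

Set Implicit Arguments.
Unset Strict Implicit.
Unset Printing Implicit Defensive.

Import Order.TTheory GRing.Theory Num.Theory.
Import numFieldNormedType.Exports.

Local Open Scope classical_set_scope.
Local Open Scope ring_scope.

(* Together with completeness of H, this makes (H, ip) a real Hilbert space. *)
Definition norm_from_dot (R : realType) (H : completeNormedModType R)
    (ip : {dot H for idfun}) : Prop :=
  forall x : H, `|x| = Num.sqrt (ip x x).

Definition nearest_point (R : realType) (H : normedModType R)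
    (Q : set H) (x p : H) : Prop :=
  Q p /\ forall y, Q y -> `|x - p| <= `|x - y|.

(* The default value 0 is never used when Q is a closed convex non-empty
   subset of a Hilbert space: the nearest point exists and is unique. *)
Definition metric_proj (R : realType) (H : normedModType R)
    (Q : set H) (x : H) : H :=
  xget 0 [set p | nearest_point Q x p].

(* Riesz representative of the Frechet differential; the default value 0 is
   never used where f is differentiable, H being a Hilbert space. *)
Definition gradient (R : realType) (H : completeNormedModType R)
    (ip : {dot H for idfun}) (f : H -> R) (x : H) : H :=
  xget 0 [set g | forall v, 'd f x v = ip g v].

Definition C1_function (R : realType) (H : completeNormedModType R)
    (ip : {dot H for idfun}) (f : H -> R) : Prop :=
  (forall x, differentiable f x) /\ continuous (gradient ip f).

Definition locally_lipschitz (R : realType) (V W : normedModType R)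
    (F : V -> W) : Prop :=
  forall x : V, exists2 U, nbhs x U & [lipschitz F y | y in U].

Definition argmin (R : realType) (T : Type) (Q : set T) (f : T -> R) : set T :=
  [set x | Q x /\ forall y, Q y -> f x <= f y].

(* A finite family of non-overlapping intervals is given by the list of their
   pairs of endpoints. *)
Definition absolutely_continuous_on (R : realType) (a b : R) (g : R -> R)
    : Prop :=
  forall e : R, 0 < e -> exists2 d, 0 < d & forall s : seq (R * R),
    all (fun I => [&& a <= I.1, I.1 <= I.2 & I.2 <= b]) s ->
    pairwise (fun I J => (I.2 <= J.1) || (J.2 <= I.1)) s ->
    \sum_(I <- s) (I.2 - I.1) < d ->
    \sum_(I <- s) `|g I.2 - g I.1| < e.

(* Derivative relative to A: two-sided at interior points of A, one-sided at
   the endpoints of an interval. *)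
Definition is_derivative_within (R : realType) (V : normedModType R)
    (A : set R) (x : R -> V) (t : R) (l : V) : Prop :=
  (s - t)^-1 *: (x s - x t) @[s --> within A t^'] --> l.

(* dx is the derivative of x; x is C^1 on [0, +oo[, and its values on negative
   times are irrelevant. *)
Definition C1_solution (R : realType) (H : completeNormedModType R)
    (ip : {dot H for idfun}) (Q : set H) (lambda : R -> R) (f : H -> R)
    (x0 : H) (x : R -> H) : Prop :=
  x 0 = x0 /\
  exists dx : R -> H,
    [/\ {within `[0, +oo[, continuous dx},
        forall t : R, 0 <= t -> is_derivative_within `[0, +oo[ x t (dx t) &
        forall t : R, 0 <= t ->
          dx t + x t =
          metric_proj Q (x t - lambda t *: gradient ip f (x t))].

(* Main.v *)
(** Write phi(t) = f(x(t)). The variational inequality of the projection reads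
    <x' + lambda grad f(x), x + x' - q> <= 0 for q in Q. With q = x it gives
    lambda phi' <= - |x'|^2, so phi is nonincreasing; with a general q and the
    convexity of f it gives
      (1/2 |x - q|^2)' + lambda phi' + lambda (phi - f q) <= 0.
    An absolutely continuous lambda with integrable derivative is bounded by
    some M, so lambda phi' may be replaced by M phi', and the energy
    1/2 |x - q|^2 + M phi decreases on ]0, t] as soon as f q <= phi(t).
    Choosing q = - x(t) in case (1), and q on the sphere of radius r around an
    interior point z of the argmin in case (2), bounds |x(s) - x(t)|^2, resp.
    r |x(s) - x(t)|, by the decrease of a fixed energy between s and t; hence x
    is Cauchy at infinity. If phi stayed above min f + c with c > 0, the dropped
    term lambda (phi - f q) would force c times the integral of lambda to be
    finite. *)
Require Import Defs.
From HB Require Import structures.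
From mathcomp Require Import all_boot all_order all_algebra.
From mathcomp Require Import sesquilinear.
From mathcomp Require Import all_classical all_reals all_analysis.
From mathcomp Require Import measurable_realfun ring lra.

Set Implicit Arguments.
Unset Strict Implicit.
Unset Printing Implicit Defensive.

Import Order.TTheory GRing.Theory Num.Theory.
Import numFieldNormedType.Exports.

Local Open Scope classical_set_scope.
Local Open Scope ring_scope.

(** * Absolutely continuous functions *)

Lemma variation_pairmap (R : numDomainType) (a b : R) (g : R -> R) (s : seq R) :
  itv_partition a b s ->
  variation a b g s = \sum_(I <- pairmap pair a s) `|g I.2 - g I.1|.
Proof.
elim: s a => [a _|c s ih a]; first by rewrite variation_nil big_nil.
move=> abs; rewrite /= big_cons -ih; last exact: itv_partition_cons abs.
by rewrite /variation /= big_nat_recl.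
Qed.

Lemma sum_pairmap_length (R : numDomainType) (a b : R) (s : seq R) :
  itv_partition a b s ->
  \sum_(I <- pairmap pair a s) (I.2 - I.1) = b - a.
Proof.
elim: s a => [a /itv_partition_nil ->|c s ih a abs]; first by rewrite big_nil subrr.
rewrite /= big_cons (ih _ (itv_partition_cons abs)) /=.
by rewrite addrC addrA subrK.
Qed.

Lemma all_pairmap_partition (R : numDomainType) (a b : R) (s : seq R) :
  itv_partition a b s ->
  all (fun I => [&& a <= I.1, I.1 <= I.2 & I.2 <= b]) (pairmap pair a s).
Proof.
elim: s a => // c s ih a abs /=.
have cb := itv_partition_cons abs.
have ac : a <= c by move: abs => [/= /andP[/ltW]].
rewrite lexx ac (itv_partition_le cb)/=.
apply: sub_all (ih _ cb) => I /and3P[cI -> ->]; rewrite andbT.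
by rewrite (le_trans ac cI).
Qed.

Lemma pairwise_pairmap_partition (R : numDomainType) (a b : R) (s : seq R) :
  itv_partition a b s ->
  pairwise (fun I J => (I.2 <= J.1) || (J.2 <= I.1)) (pairmap pair a s).
Proof.
elim: s a => // c s ih a abs /=.
have cb := itv_partition_cons abs.
rewrite (ih _ cb) andbT.
by apply: sub_all (all_pairmap_partition cb) => I /= /and3P[->].
Qed.

Lemma bounded_variation_fin_num (R : realType) (a b c d : R) (g : R -> R) :
  a <= c -> c <= d -> d <= b -> bounded_variation a b g ->
  total_variation c d g \is a fin_num.
Proof.
move=> ac cd db BVg; apply/bounded_variationP => //; apply: (bounded_variationl cd db).
exact: bounded_variationr (le_trans cd db) BVg.
Qed.

(** Each interval of [s] may be cut along a partition: its length is unchanged and non-overlap is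
    preserved, so absolute continuity bounds the refined sum, and the supremum over partitions is
    taken one interval at a time. The list [s'] collects the intervals already cut, so the induction
    on [s] generalizes over it. *)
Lemma absolutely_continuous_on_variation (R : realType) (a b : R) (g : R -> R) :
  absolutely_continuous_on a b g ->
  forall e, 0 < e -> exists2 d, 0 < d & forall s s' : seq (R * R),
    all (fun I => [&& a <= I.1, I.1 <= I.2 & I.2 <= b]) (s ++ s') ->
    pairwise (fun I J => (I.2 <= J.1) || (J.2 <= I.1)) (s ++ s') ->
    \sum_(I <- s ++ s') (I.2 - I.1) < d ->
    (\sum_(I <- s) total_variation I.1 I.2 g +
     (\sum_(I <- s') `|g I.2 - g I.1|)%:E <= e%:E)%E.
Proof.
move=> acg e e0; have [d d0 gd] := acg _ e0; exists d => // s.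
elim: s => [s' al pw sd|[u v] s ih s' al pw sd].
  by rewrite big_nil add0e lee_fin ltW// gd.
rewrite big_cons -addeA.
move: al; rewrite /= => /andP[/and3P[au uv vb] al].
move: pw; rewrite /= => /andP[alI pw].
have S0 : (0 <= \sum_(I <- s) total_variation I.1 I.2 g +
     (\sum_(I <- s') `|g I.2 - g I.1|)%:E)%E.
  apply: adde_ge0; last by rewrite lee_fin sumr_ge0.
  rewrite big_seq; apply: sume_ge0 => I Is; apply: total_variation_ge0.
  by move/allP : al => /(_ I); rewrite mem_cat Is => /(_ isT) /and3P[].
have key p : itv_partition u v p ->
  ((variation u v g p)%:E + (\sum_(I <- s) total_variation I.1 I.2 g +
     (\sum_(I <- s') `|g I.2 - g I.1|)%:E) <= e%:E)%E.
  move=> uvp; rewrite (variation_pairmap _ uvp) addeCA -EFinD -big_cat /=.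
  have al2 := all_pairmap_partition uvp.
  apply: ih.
  - rewrite !all_cat; move: al; rewrite all_cat => /andP[-> ->]/=.
    rewrite andbT; apply: sub_all al2 => I /and3P[uI -> Iv].
    by rewrite (le_trans au uI) (le_trans Iv vb).
  - have pwI := pairwise_pairmap_partition uvp.
    move: pw; rewrite !pairwise_cat => /and3P[ss' -> ->].
    rewrite pwI !andbT /= allrel_catr ss' /= andbT.
    move: alI; rewrite all_cat => /andP[als als'].
    apply/andP; split.
      apply/allrelP => I J Is Jp.
      move/allP : als => /(_ _ Is) /=; move/allP : al2 => /(_ _ Jp) /and3P[uJ _ Jv].
      case/orP => [vI|Iu]; first by rewrite (le_trans Jv vI) orbT.
      by rewrite (le_trans Iu uJ).
    apply/allrelP => J I Jp Is.
    move/allP : als' => /(_ _ Is) /=; move/allP : al2 => /(_ _ Jp) /and3P[uJ _ Jv].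
    case/orP => [vI|Iu]; first by rewrite (le_trans Jv vI).
    by rewrite (le_trans Iu uJ) orbT.
  - move: sd; rewrite big_cons /= !big_cat /= (sum_pairmap_length uvp).
    by rewrite [X in _ -> X < _]addrCA.
(* Finiteness allows this term to be moved to the right-hand side before the supremum over [p] is
   taken. *)
have Sfin : (\sum_(I <- s) total_variation I.1 I.2 g +
     (\sum_(I <- s') `|g I.2 - g I.1|)%:E)%E \is a fin_num.
  rewrite ge0_fin_numE//.
  have [u_v|u_v] := eqVneq u v.
    have /key : itv_partition u v [::] by split => //=; rewrite u_v.
    rewrite variation_nil add0e => /le_lt_trans; apply; exact: ltry.
  have /itv_partition1 /key : u < v by rewrite lt_neqAle u_v.
  move=> h; apply: (@le_lt_trans _ _ e%:E); last exact: ltry.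
  by apply: le_trans h; rewrite leeDr// lee_fin variation_ge0.
rewrite -leeBrDr//; apply: ge_ereal_sup => /= _ [_ [p uvp <-] <-].
by rewrite leeBrDr//; exact: key.
Qed.

(** For [e = 1] the variation is at most 1 on every subinterval shorter than [d], and finitely many
    steps of length [d / 2] cover [[a, b]]. *)
Lemma absolutely_continuous_on_bounded_variation (R : realType) (a b : R)
    (g : R -> R) :
  a <= b -> absolutely_continuous_on a b g -> bounded_variation a b g.
Proof.
move=> ab /absolutely_continuous_on_variation /(_ _ ltr01) [d d0 gd].
have step u v : a <= u -> u <= v -> v <= b -> v - u < d ->
    (total_variation u v g < +oo)%E.
  move=> au uv vb uvd; have := gd [:: (u, v)] [::].
  rewrite /= au uv vb => /(_ isT isT); rewrite !big_seq1 big_nil /= adde0.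
  by move=> /(_ uvd) /le_lt_trans; apply; exact: ltry.
have fin n u : a <= u -> u <= b -> u - a <= n%:R * (d / 2) ->
    (total_variation a u g < +oo)%E.
  elim: n u => [|n ih] u au ub.
    rewrite mul0r subr_le0 => ua.
    by have -> : u = a; [apply/le_anti; rewrite ua | rewrite total_variationxx].
  rewrite -natr1 mulrDl mul1r => und.
  (* Left end of the last step, cut off at [a]. *)
  pose w := Order.max a (u - d / 2).
  have aw : a <= w by rewrite le_max lexx.
  have wu : w <= u by rewrite ge_max au gerBl divr_ge0// ltW.
  have uw : u - d / 2 <= w by rewrite le_max lexx orbT.
  rewrite (total_variationD _ aw wu) lte_add_pinfty//.
    apply: ih => //; first exact: le_trans ub.
    rewrite lerBlDr ge_max lerDr mulr_ge0 ?divr_ge0 ?(ltW d0)//=.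
    by move: und; lra.
  by apply: step => //; lra.
apply/bounded_variationP => //; rewrite ge0_fin_numE ?total_variation_ge0//.
pose n := Num.bound ((b - a) / (d / 2)).
apply: (fin n) => //; rewrite -ler_pdivrMr ?divr_gt0// ltW//.
by apply: le_lt_trans (archi_boundP _); rewrite ?lexx// !divr_ge0 ?subr_ge0// ltW.
Qed.

Lemma absolutely_continuous_onB (R : realType) (a b : R) (f g : R -> R) :
  absolutely_continuous_on a b f -> absolutely_continuous_on a b g ->
  absolutely_continuous_on a b (f \- g).
Proof.
move=> acf acg e e0; have e20 : 0 < e / 2 by rewrite divr_gt0.
have [d d0 fd] := acf _ e20; have [d' d'0 gd] := acg _ e20.
exists (Order.min d d'); first by rewrite lt_min d0.
move=> s al pw; rewrite lt_min => /andP[sd sd'].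
rewrite [ltRHS]splitr; apply: le_lt_trans (ltrD (fd _ al pw sd) (gd _ al pw sd')).
rewrite -big_split /=; apply: ler_sum => I _.
have -> : f I.2 - g I.2 - (f I.1 - g I.1) = (f I.2 - f I.1) - (g I.2 - g I.1).
  by ring.
exact: ler_normB.
Qed.

(** By additivity the increment over an interval is the total variation there, which
    [absolutely_continuous_on_variation] controls with [s'] empty. That bound is not strict, hence
    [e / 2]. *)
Lemma absolutely_continuous_on_total_variation (R : realType) (a b : R)
    (g : R -> R) :
  a <= b -> absolutely_continuous_on a b g ->
  absolutely_continuous_on a b (fun x => fine (total_variation a x g)).
Proof.
move=> ab acg e e0; have BVg := absolutely_continuous_on_bounded_variation ab acg.
have e20 : 0 < e / 2 by rewrite divr_gt0.
have [d d0 gd] := absolutely_continuous_on_variation acg e20.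
exists d => // s al pw sd.
have := gd s [::]; rewrite cats0 big_nil adde0 => /(_ al pw sd) sTV.
apply: (@le_lt_trans _ _ (e / 2)); last by rewrite ltr_pdivrMr// mulr_natr mulr2n ltrDl.
rewrite -lee_fin; apply: le_trans sTV; rewrite -sumEFin big_seq [leRHS]big_seq.
apply: lee_sum => I Is; move/allP: al => /(_ _ Is) /and3P[aI I12 Ib].
have fTV u v : a <= u -> u <= v -> v <= b -> total_variation u v g \is a fin_num.
  by move=> au uv vb; exact: bounded_variation_fin_num BVg.
have aI2 := le_trans aI I12; have I1b := le_trans I12 Ib.
rewrite (total_variationD g aI I12) fineD ?fTV// addrC addKr ger0_norm.
  by rewrite fineK ?fTV.
by rewrite fine_ge0// total_variation_ge0.
Qed.

(** An increment of [g] never exceeds its variation over the same interval. This gives the second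
    term of the Jordan decomposition g = V - (V - g). *)
Lemma nondecreasing_total_variationB (R : realType) (a b : R) (g : R -> R) :
  bounded_variation a b g ->
  {in `[a, b] &, nondecreasing_fun (fun x => fine (total_variation a x g) - g x)}.
Proof.
move=> BVg u v; rewrite !in_itv/= => /andP[au ub] /andP[av vb] uv.
have fTV u' v' : a <= u' -> u' <= v' -> v' <= b -> total_variation u' v' g \is a fin_num.
  by move=> au' uv' vb'; exact: bounded_variation_fin_num BVg.
rewrite lerBrDr -addrA -lerBrDl (total_variationD g au uv) fineD ?fTV//.
rewrite [leRHS]addrC addKr addrC.
apply: (le_trans (ler_norm _)).
by rewrite -lee_fin fineK ?fTV//; exact: total_variation_ge.
Qed.

Lemma nondecreasing_fine_total_variation (R : realType) (a b : R) (g : R -> R) :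
  bounded_variation a b g ->
  {in `[a, b] &, nondecreasing_fun (fun x => fine (total_variation a x g))}.
Proof.
move=> BVg u v; rewrite !in_itv/= => /andP[au ub] /andP[av vb] uv.
have fTV u' v' : a <= u' -> u' <= v' -> v' <= b -> total_variation u' v' g \is a fin_num.
  by move=> au' uv' vb'; exact: bounded_variation_fin_num BVg.
by rewrite (total_variationD g au uv) fineD ?fTV// lerDl fine_ge0// total_variation_ge0.
Qed.

Lemma absolutely_continuous_on_continuous (R : realType) (a b : R) (g : R -> R) :
  absolutely_continuous_on a b g -> {within `[a, b], continuous g}.
Proof.
move=> acg; apply/subspace_continuousP => u /=; rewrite in_itv/= => /andP[au ub].
apply/cvgrPdist_lt => e e0; have [d d0 gd] := acg _ e0.
rewrite near_withinE; near=> v => /=; rewrite in_itv/= => /andP[av vb].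
have uvd : `|u - v| < d by near: v; exact: cvgr_dist_lt.
have [uv|/ltW vu] := leP u v.
  rewrite distrC; have := gd [:: (u, v)]; rewrite /= au uv vb !big_seq1/=.
  by apply => //; apply: le_lt_trans uvd; rewrite distrC ler_norm.
have := gd [:: (v, u)]; rewrite /= av ub vu !big_seq1/=; apply => //.
by apply: le_lt_trans uvd; rewrite ler_norm.
Unshelve. all: by end_near. Qed.

(** * Densities of absolutely continuous functions *)

Lemma open_interval_infsup (R : realType) (X : set R) :
  open X -> is_interval X -> has_lbound X -> has_ubound X ->
  X = [set r | inf X < r < sup X].
Proof.
move=> oX iX lX uX; rewrite -interval_bounded_interior//.
by apply/esym/interior_id.
Qed.

(** Outer regularity encloses [A] in an open set of Lebesgue measure below [d]. Finitely many of its
    components are non-overlapping intervals of total length below [d], so their Stieltjes mass is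
    at most [e]; countable additivity passes to all components. *)
Lemma lebesgue_stieltjes_null (R : realType) (G : cumulative R R)
    (acG : forall e : R, 0 < e -> exists2 d, 0 < d & forall s : seq (R * R),
      all (fun I => I.1 <= I.2) s ->
      pairwise (fun I J => (I.2 <= J.1) || (J.2 <= I.1)) s ->
      \sum_(I <- s) (I.2 - I.1) < d ->
      \sum_(I <- s) (G I.2 - G I.1) < e)
    (u v : R) (A : set (measurableTypeR R)) :
  measurable A -> A `<=` `]u, v[%classic ->
  lebesgue_measure A = 0%E -> lebesgue_stieltjes_measure G A = 0%E.
Proof.
move=> mA Auv A0; apply/eqP; rewrite eq_le measure_ge0 andbT.
apply/lee_addgt0Pr => e e0; rewrite add0e.
have [d d0 Gd] := acG _ e0.
have Aoo : (lebesgue_measure A < +oo)%E by rewrite A0 ltry.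
have [U [oU AU UAd]] := lebesgue_regularity_outer mA Aoo d0.
(* Cutting with []u, v[] makes every component bounded, so that [inf] and [sup] are its
   endpoints. *)
pose W : set (measurableTypeR R) := U `&` `]u, v[%classic.
have oW : open (W : set R) by apply: openI => //; exact: interval_open.
have AW : A `<=` W by move=> t At; split; [exact: AU | exact: Auv].
have mU : measurable (U : set (measurableTypeR R)) by exact: open_measurable.
have mW : measurable W by exact: open_measurable.
have Wd : (lebesgue_measure W < d%:E)%E.
  have {}UAd : (lebesgue_measure (U `\` A) < d%:E)%E := UAd.
  apply: le_lt_trans UAd.
  have -> : lebesgue_measure (U `\` A) = lebesgue_measure U.
    by rewrite [RHS](measureDI lebesgue_measure mU mA) (setIidr AU) [X in (_ + X)%E]A0 adde0.
  by apply: le_measure; rewrite ?inE//; exact: subIsetl.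
apply: (@le_trans _ _ (lebesgue_stieltjes_measure G W)).
  by apply: le_measure; rewrite ?inE.
pose I k : set (measurableTypeR R) := open_disjoint_itv oW k.
have IW k : I k `<=` W.
  by rewrite (open_disjoint_itv_bigcup oW) => t It; exists k.
have tI : trivIset setT I := @open_disjoint_itv_trivIset R W oW.
have oI k : open (I k : set R) := @open_disjoint_itv_open R W oW k.
have mI k : measurable (I k) by exact: open_measurable (oI k).
have lI k : has_lbound (I k : set R).
  by exists u => t /IW[_] /=; rewrite in_itv/= => /andP[/ltW].
have uI k : has_ubound (I k : set R).
  by exists v => t /IW[_] /=; rewrite in_itv/= => /andP[_ /ltW].
have IE k : (I k : set R) = [set r | inf (I k : set R) < r < sup (I k : set R)].
  by apply: open_interval_infsup => //; exact: open_disjoint_itv_is_interval.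
have IP k t : I k t = (inf (I k : set R) < t < sup (I k : set R)) :> Prop.
  exact: (congr1 (@^~ t) (IE k)).
have I0 k : I k != set0 -> inf (I k : set R) < sup (I k : set R).
  by move=> /set0P[t]; rewrite IP => /andP[st ts]; exact: lt_trans ts.
rewrite [X in lebesgue_stieltjes_measure G X](open_disjoint_itv_bigcup oW).
rewrite measure_semi_bigcup//; last by exact: bigcup_measurable.
apply: lime_le; first exact: is_cvg_nneseries.
apply: nearW => n.
pose p k := (inf (I k : set R), sup (I k : set R)).
(* Empty terms of the enumeration, whose [inf] and [sup] are default values, are filtered out. *)
pose s := [seq p k | k <- index_iota 0 n & I k != set0].
have als : all (fun I => I.1 <= I.2) s.
  by apply/allP => _ /mapP[k + ->]; rewrite mem_filter => /andP[/I0/ltW].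
have pws : pairwise (fun I J => (I.2 <= J.1) || (J.2 <= I.1)) s.
  rewrite pairwise_map.
  apply: (@sub_in_pairwise _ [pred k | I k != set0] [rel k l | k != l]); last first.
  - by rewrite -uniq_pairwise filter_uniq// iota_uniq.
  - by apply/allP => k; rewrite mem_filter => /andP[].
  move=> k l /I0 Ik /I0 Il kl /=; rewrite leNgt (leNgt (sup _)) -negb_and.
  apply/negP => /andP[lk kl'].
  (* Midpoint of the overlap: it would belong to two disjoint components. *)
  pose m := (Order.max (inf (I k : set R)) (inf (I l : set R)) +
             Order.min (sup (I k : set R)) (sup (I l : set R))) / 2.
  have mm : Order.max (inf (I k : set R)) (inf (I l : set R)) <
             Order.min (sup (I k : set R)) (sup (I l : set R)).
    by rewrite gt_max !lt_min Ik Il kl' lk.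
  have [] := midf_lt mm; rewrite -/m gt_max lt_min => /andP[mk ml] /andP[mk' ml'].
  have : (I k `&` I l) m by split; rewrite IP; apply/andP; split.
  by move/trivIsetP: tI => /(_ _ _ Logic.I Logic.I kl) ->.
have E k : I k != set0 -> lebesgue_measure (I k) =
    (sup (I k : set R) - inf (I k : set R))%:E.
  move=> /I0 Ik; rewrite {1}IE (_ : [set r | _] = `]inf (I k : set R), sup (I k : set R)[%classic).
    by rewrite lebesgue_measure_itv/= lte_fin Ik.
  by apply/seteqP; split => t /=; rewrite in_itv.
have sd : \sum_(J <- s) (J.2 - J.1) < d.
  rewrite -lte_fin; apply: le_lt_trans Wd.
  rewrite big_map big_filter -sumEFin (eq_bigr (fun k => lebesgue_measure (I k))); last first.
    by move=> k /E ->.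
  rewrite [X in lebesgue_measure X](open_disjoint_itv_bigcup oW).
  rewrite measure_semi_bigcup//; last by exact: bigcup_measurable.
  apply: (@le_trans _ _ (\sum_(0 <= k < n) lebesgue_measure (I k))%E).
    by rewrite [leRHS](bigID (fun k => I k != set0))/= leeDl// sume_ge0.
  by apply: nneseries_lim_ge.
have Gs := Gd s als pws sd.
apply: (@le_trans _ _ (\sum_(J <- s) (G J.2 - G J.1))%:E); last by rewrite lee_fin ltW.
rewrite big_map big_filter -sumEFin (bigID (fun k => I k != set0))/= [X in (_ + X)%E]big1.
  rewrite adde0; apply: lee_sum => k /I0 Ik.
  (* Adding the right endpoint gives an interval whose Stieltjes measure is exactly the increment of
     [G]. *)
  apply: (@le_trans _ _ (lebesgue_stieltjes_measure G `]inf (I k : set R), sup (I k : set R)]%classic)).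
    apply: le_measure; rewrite ?inE//.
    by move=> t; rewrite -[open_disjoint_itv oW k]/(I k) IP /= in_itv/= => /andP[-> /ltW ->].
  rewrite /lebesgue_stieltjes_measure /measure_extension measurable_mu_extE/=; last exact: is_ocitv.
  by rewrite wlength_itv_bnd// ltW.
by move=> k; rewrite negbK -[open_disjoint_itv oW k]/(I k) => /eqP ->; exact: measure0.
Qed.

(** Nearest point of [[a, b]]: composing with it extends a function on [[a, b]] to the whole line by
    constants. *)
Definition clamp (R : realType) (a b x : R) : R := Order.max a (Order.min x b).

Lemma clamp_id (R : realType) (a b x : R) : a <= x -> x <= b -> clamp a b x = x.
Proof. by move=> ax xb; rewrite /clamp (min_idPl xb) (max_idPr ax). Qed.

Lemma clamp_itv (R : realType) (a b x : R) :
  a <= b -> a <= clamp a b x <= b.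
Proof.
by move=> ab; rewrite /clamp le_max lexx/= ge_max ab ge_min lexx orbT.
Qed.

Lemma le_clamp (R : realType) (a b : R) : {homo clamp a b : x y / x <= y}.
Proof.
move=> x y xy; rewrite /clamp ge_max !le_max lexx/= le_min !ge_min xy lexx.
by rewrite !orbT.
Qed.

Lemma clamp_contraction (R : realType) (a b x y : R) :
  a <= b -> x <= y -> clamp a b y - clamp a b x <= y - x.
Proof.
by move=> ab xy; rewrite /clamp !maxEle !minEle; do !case: ifPn; lra.
Qed.

(** [clamp] is nondecreasing and 1-Lipschitz, so it sends a non-overlapping family to a
    non-overlapping family in [[a, b]] of no larger total length. *)
Lemma absolutely_continuous_on_clamp (R : realType) (a b : R) (F : R -> R) :
  a <= b -> absolutely_continuous_on a b F ->
  forall e : R, 0 < e -> exists2 d, 0 < d & forall s : seq (R * R),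
      all (fun I => I.1 <= I.2) s ->
      pairwise (fun I J => (I.2 <= J.1) || (J.2 <= I.1)) s ->
      \sum_(I <- s) (I.2 - I.1) < d ->
      \sum_(I <- s) `|F (clamp a b I.2) - F (clamp a b I.1)| < e.
Proof.
move=> ab acF e e0; have [d d0 Fd] := acF _ e0; exists d => // s al pw sd.
have := Fd [seq (clamp a b K.1, clamp a b K.2) | K <- s].
rewrite !big_map; apply.
- apply/allP => _ /mapP[K Is ->] /=.
  have /andP[-> _] := clamp_itv K.1 ab; have /andP[_ /= ->] := clamp_itv K.2 ab.
  by rewrite le_clamp//; move/allP : al => /(_ _ Is).
- rewrite pairwise_map; apply: sub_pairwise pw => K J /=.
  by case/orP => /(le_clamp a b) ->; rewrite ?orbT.
- apply: le_lt_trans sd; rewrite big_seq [leRHS]big_seq; apply: ler_sum => K Is.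
  by apply: clamp_contraction => //; move/allP : al => /(_ _ Is).
Qed.

(** Extended by constants, [F] defines a Stieltjes measure, made finite by restriction to []a, b]].
    Absolute continuity makes it dominated by Lebesgue measure, and the density is its Radon-Nikodym
    derivative. *)
Lemma nondecreasing_density (R : realType) (a b : R) (F : R -> R) :
  a < b -> {in `[a, b] &, nondecreasing_fun F} ->
  absolutely_continuous_on a b F ->
  exists2 h : R -> R,
    (@lebesgue_measure R).-integrable setT (EFin \o h) &
    forall x, x \in `[a, b] ->
      (\int[lebesgue_measure]_(t in `]a, x]) (h t)%:E = (F x - F a)%:E)%E.
Proof.
move=> ab ndF acF; pose G0 := F \o clamp a b.
have acG0 := absolutely_continuous_on_clamp (ltW ab) acF.
have ndG0 : nondecreasing G0.
  by move=> x y xy; apply: ndF; rewrite ?in_itv/= ?clamp_itv ?le_clamp// ltW.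
have rcG0 : right_continuous G0.
  move=> x; apply/cvgrPdist_lt => e e0; have [d d0 Gd] := acG0 _ e0.
  near=> y; have xy : x <= y by near: y; exact: nbhs_right_ge.
  rewrite distrC; have := Gd [:: (x, y)]; rewrite /= xy !big_seq1/=; apply => //.
  by rewrite ltrBlDl; near: y; apply: nbhs_right_lt; rewrite ltrDl.
pose G : cumulative R R := HB.pack G0 (isCumulative.Build R _ R G0 ndG0 rcG0).
have acG e : 0 < e -> exists2 d, 0 < d & forall s : seq (R * R),
      all (fun I => I.1 <= I.2) s ->
      pairwise (fun I J => (I.2 <= J.1) || (J.2 <= I.1)) s ->
      \sum_(I <- s) (I.2 - I.1) < d ->
      \sum_(I <- s) (G I.2 - G I.1) < e.
  move=> /acG0[d d0 Gd]; exists d => // s al pw sd.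
  apply: le_lt_trans (Gd s al pw sd); apply: ler_sum => I _; exact: ler_norm.
pose D : set (measurableTypeR R) := `]a, b]%classic.
have mD : measurable D by exact: (@measurable_itv R `]a, b]).
pose mu := lebesgue_stieltjes_measure G.
have muE x : x \in `[a, b] -> mu `]a, x]%classic = (F x - F a)%:E.
  rewrite in_itv/= => /andP[ax xb].
  rewrite /mu /lebesgue_stieltjes_measure /measure_extension.
  rewrite measurable_mu_extE/=; last exact: is_ocitv.
  by rewrite wlength_itv_bnd//= /G0/= !clamp_id// ltW.
have muD : (mu D < +oo)%E by rewrite muE ?ltry// in_itv/= lexx ltW.
pose nu := mfrestr mD muD.
have nudom : nu `<< lebesgue_measure.
  apply/null_content_dominatesP => A mA A0; rewrite /nu /mfrestr /mrestr.
  (* [b + 1] because []a, b]] has to sit inside an open interval. *)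
  apply: (@lebesgue_stieltjes_null _ G acG a (b + 1)).
  - exact: measurableI.
  - move=> t [_]; rewrite /D /= !in_itv/= => /andP[-> tb]/=.
    by rewrite (le_lt_trans tb)// ltrDl.
  - apply/eqP; rewrite eq_le measure_ge0 andbT -A0.
    by apply: le_measure; rewrite ?inE//; exact: measurableI.
have [h [h0 hfin inth nuh]] := radon_nikodym_sigma_finite nudom.
have hE : h = EFin \o (fine \o h) by apply/funext => t /=; rewrite fineK.
exists (fine \o h); first by rewrite -hE.
move=> x xab; rewrite -(muE x xab).
transitivity (\int[lebesgue_measure]_(t in `]a, x]) h t)%E.
  by apply: eq_integral => t _ /=; rewrite fineK.
rewrite -nuh; last exact: (@measurable_itv R `]a, x]).
rewrite /= /mfrestr /mrestr setIidl// => t /=; move: xab.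
rewrite /D /= !in_itv/= => /andP[_ xb] /andP[-> tx]/=.
exact: le_trans xb.
Unshelve. all: by end_near. Qed.

(** The density is the difference of the densities of the two nondecreasing terms V and V - g of the
    Jordan decomposition. *)
Lemma absolutely_continuous_density (R : realType) (a b : R) (g : R -> R) :
  a < b -> absolutely_continuous_on a b g ->
  exists2 h : R -> R,
    (@lebesgue_measure R).-integrable setT (EFin \o h) &
    forall x, x \in `[a, b] ->
      (\int[lebesgue_measure]_(t in `]a, x]) (h t)%:E = (g x - g a)%:E)%E.
Proof.
move=> ab acg; have BVg := absolutely_continuous_on_bounded_variation (ltW ab) acg.
have acV := absolutely_continuous_on_total_variation (ltW ab) acg.
have [hV iV VE] := nondecreasing_density ab (nondecreasing_fine_total_variation BVg) acV.
have [hW iW WE] := nondecreasing_density ab (nondecreasing_total_variationB BVg)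
  (absolutely_continuous_onB acV acg).
exists (hV \- hW); first by exact: integrableB iV iW.
move=> x xab; have m : measurable (`]a, x]%classic : set (measurableTypeR R)).
  exact: (@measurable_itv R `]a, x]).
have S h : (@lebesgue_measure R).-integrable setT (EFin \o h) ->
    (@lebesgue_measure R).-integrable `]a, x]%classic (EFin \o h).
  by move=> ih; apply: integrableS ih.
under eq_integral do rewrite EFinB.
rewrite integralB//; [|exact: S|exact: S].
rewrite VE// WE// -EFinB; congr EFin; ring.
Qed.

(* g need not be measurable: the integral of a nonnegative function is the
   supremum of the integrals of the simple functions below it. *)
Lemma ge0_le_integralS d (T : measurableType d) (R : realType)
    (mu : {measure set T -> \bar R}) (D E : set T) (f g : T -> \bar R) :
  D `<=` E -> (forall x, D x -> 0 <= f x)%E -> (forall x, E x -> 0 <= g x)%E ->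
  (forall x, D x -> f x <= g x)%E ->
  (\int[mu]_(x in D) f x <= \int[mu]_(x in E) g x)%E.
Proof.
move=> DE f0 g0 fg; rewrite !ge0_integralE//.
apply: le_ereal_sup => _ [h hf <-]; exists h => // x.
apply: le_trans (hf x) _; rewrite !patchE.
case: ifPn => [|_]; last by case: ifPn => //; rewrite inE; exact: g0.
by rewrite inE => Dx; rewrite mem_set ?fg//; exact: DE.
Qed.

(** Near an interior point, [g] is a primitive of its density [h] up to a constant, so Lebesgue
    differentiation gives g' = h almost everywhere. The increment of [g] is the integral of [h], and
    the exceptional null set is removed before |h| is compared with |g'|. *)
Lemma absolutely_continuous_le_integral_derive1 (R : realType) (a b : R)
    (g : R -> R) :
  a < b -> absolutely_continuous_on a b g ->
  (`|g b - g a|%:E <= \int[lebesgue_measure]_(t in `[a, b]) `|derive1 g t|%:E)%E.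
Proof.
move=> ab acg; have [h ih gE] := absolutely_continuous_density ab acg.
have m x : measurable (`]a, x]%classic : set (measurableTypeR R)).
  exact: (@measurable_itv R `]a, x]).
have iS x : (@lebesgue_measure R).-integrable `]a, x]%classic (EFin \o h).
  by apply: integrableS ih.
have [N [mN N0 hN]] : {ae lebesgue_measure, forall x : R, a < x -> x < b -> derive1 g x = h x}.
  have /lebesgue_differentiation := open_integrable_locally openT ih.
  apply: filterS; first exact: (ae_filter_ringOfSetsType lebesgue_measure).
  move=> x hx ax xb.
  have axb : (BRight a < BRight x)%O by rewrite bnd_simp.
  have [dF <-] := FTC1_lebesgue_pt xb (iS b) axb hx.
  set F := (F in derivable F _ _) in dF *.
  have gF : \near x, g x = F x + g a.
    near=> y; rewrite /F /Rintegral gE ?subrK// in_itv/=; apply/andP; split.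
      by apply: ltW; near: y; exact: lt_nbhsr.
    by apply: ltW; near: y; exact: lt_nbhsl.
  by rewrite !derive1E (near_eq_derive _ gF) (deriveD dF)// derive_cst addr0.
(* The equality g' = h is known only strictly before [b], so [b] joins the null set. *)
pose M : set (measurableTypeR R) := N `|` [set b].
have mM : measurable M by apply: measurableU => //; exact: measurable_set1.
have M0 : lebesgue_measure M = 0%E.
  apply/eqP; rewrite eq_le measure_ge0 andbT.
  apply: (le_trans (measureU2 _ mN (measurable_set1 b))).
  rewrite [X in (X + _)%E]N0 add0e.
  by rewrite [leLHS](lebesgue_measure_set1 b).
have mh := measurable_int _ (iS b).
have bab : b \in `[a, b] by rewrite in_itv/= lexx ltW.
rewrite -abse_EFin -(gE b bab); apply: le_trans (le_abse_integral _ _ mh) _ => //.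
rewrite (ge0_negligible_integral mM)//; last by exact: measurableT_comp.
apply: ge0_le_integralS => [t [] /=| | |] //.
  by rewrite !in_itv/= => /andP[/ltW -> ->].
move=> t [] /=; rewrite in_itv/= => /andP[at_ tb] tM.
have {}tb : t < b.
  by rewrite lt_neqAle tb andbT; apply/eqP => tb'; apply: tM; right.
rewrite (_ : derive1 g t = h t)//; apply: contrapT => Ngh; apply: tM; left.
by apply: hN => /= H; apply: Ngh; exact: H.
Unshelve. all: by end_near. Qed.

(** The bound is [g 0] plus the integral of |g'|. Applied to [lambda], it provides the constant of
    the energy. *)
Lemma absolutely_continuous_bounded (R : realType) (g : R -> R) :
  (forall T : R, 0 <= T -> absolutely_continuous_on 0 T g) ->
  (\int[lebesgue_measure]_(t in `[0%R, +oo[) `|derive1 g t|%:E < +oo)%E ->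
  exists M, forall t, 0 <= t -> g t <= M.
Proof.
move=> acg ioo; set J := integral _ _ _ in ioo.
have J0 : (0 <= J)%E by apply: integral_ge0.
exists (g 0 + fine J) => t; rewrite le_eqVlt => /predU1P[<-|t0].
  by rewrite lerDl fine_ge0.
rewrite -lerBlDl; apply: le_trans (ler_norm _) _.
rewrite -lee_fin fineK ?ge0_fin_numE//.
apply: le_trans (absolutely_continuous_le_integral_derive1 t0 (acg _ (ltW t0))) _.
apply: ge0_le_integralS => //; exact: subset_itvl.
Qed.

(** * Real Hilbert spaces *)

Section hilbert.
Context (R : realType) (H : completeNormedModType R) (ip : {dot H for idfun}).

Lemma dotC (u v : H) : ip u v = ip v u.
Proof. by rewrite hermC expr0 mul1r. Qed.

Lemma dotDr (u v w : H) : ip u (v + w) = ip u v + ip u w.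
Proof. exact: raddfD. Qed.

Lemma dotNr (u v : H) : ip u (- v) = - ip u v.
Proof. exact: raddfN. Qed.

Lemma dotBr (u v w : H) : ip u (v - w) = ip u v - ip u w.
Proof. exact: raddfB. Qed.

Lemma dotZr (a : R) (u v : H) : ip u (a *: v) = a * ip u v.
Proof. exact: linearZ. Qed.

Lemma dotDl (u v w : H) : ip (u + v) w = ip u w + ip v w.
Proof. by rewrite dotC dotDr (dotC w u) (dotC w v). Qed.

Lemma dotNl (u v : H) : ip (- u) v = - ip u v.
Proof. by rewrite dotC dotNr (dotC v). Qed.

Lemma dotBl (u v w : H) : ip (u - v) w = ip u w - ip v w.
Proof. by rewrite dotDl dotNl. Qed.

Lemma dotZl (a : R) (u v : H) : ip (a *: u) v = a * ip u v.
Proof. by rewrite dotC dotZr (dotC v). Qed.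

Lemma dot0r (u : H) : ip u 0 = 0.
Proof. exact: raddf0. Qed.

Lemma dot_ge0 (u : H) : 0 <= ip u u.
Proof. by have [->|u0] := eqVneq u 0; rewrite ?dot0r// ltW// neq0_dnorm_gt0. Qed.

Definition dotE := (dotDl, dotBl, dotZl, dotNl, dotDr, dotBr, dotZr, dotNr).

Hypothesis hilbertH : norm_from_dot ip.

Lemma dot_norm (u : H) : ip u u = `|u| ^+ 2.
Proof. by rewrite hilbertH sqr_sqrtr// dot_ge0. Qed.

(** The squared norm of <v,v> u - <u,v> v equals <v,v> (|u|^2 |v|^2 - <u,v>^2). *)
Lemma cauchy_schwarz (u v : H) : `|ip u v| <= `|u| * `|v|.
Proof.
have [->|v0] := eqVneq v 0; first by rewrite dot0r normr0 normr0 mulr0.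
have vv0 : 0 < ip v v by exact: neq0_dnorm_gt0.
rewrite -(@ler_sqr _ _ (`|u| * `|v|)) ?nnegrE ?mulr_ge0//.
rewrite exprMn real_normK ?num_real// -!dot_norm.
rewrite -subr_ge0 -(pmulr_rge0 _ vv0).
rewrite (_ : _ * _ = ip (ip v v *: u - ip u v *: v) (ip v v *: u - ip u v *: v)).
  exact: dot_ge0.
by rewrite !dotE (dotC v u); ring.
Qed.

Lemma normD_sqr (u v : H) :
  `|u + v| ^+ 2 = `|u| ^+ 2 + 2 * ip v u + `|v| ^+ 2.
Proof. by rewrite -!dot_norm !dotE (dotC u v); ring. Qed.

Lemma parallelogram (u v : H) :
  `|u + v| ^+ 2 + `|u - v| ^+ 2 = 2 * `|u| ^+ 2 + 2 * `|v| ^+ 2.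
Proof. by rewrite -!dot_norm !dotE (dotC v u); ring. Qed.

(** * Projection on a closed convex set *)

Variable Q : set H.
Hypotheses (closedQ : closed Q) (convexQ : convex_set Q).

Lemma convex_segment (u v : H) (t : R) :
  0 <= t -> t <= 1 -> Q u -> Q v -> Q (u + t *: (v - u)).
Proof.
move=> t0 t1 Qu Qv.
have := @convexQ v u (Itv01 t0 t1) (mem_set Qv) (mem_set Qu).
rewrite inE; congr Q.
change (t *: v + (1 - t) *: u = u + t *: (v - u)).
by rewrite scalerBl scale1r scalerBr addrCA.
Qed.

(** A minimizing sequence is Cauchy by the parallelogram identity; its limit lies in [Q] and
    realizes the distance. *)
Lemma nearest_point_exists (x : H) : Q !=set0 -> exists p, nearest_point Q x p.
Proof.
move=> [q0 Qq0]; pose D := [set `|x - y| | y in Q].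
have D0 : has_inf D.
  by split; [exists `|x - q0|, q0 | exists 0 => _ [y _ <-]].
pose d := inf D.
have dle y : Q y -> d <= `|x - y| by move=> Qy; apply: ge_inf; [case: D0|exists y].
have d0 : 0 <= d by apply: lb_le_inf; [case: D0|move=> _ [y _ <-]].
(* The midpoint of [y] and [z] is at distance at least [d] from [x], so |y - z|^2 <= 4 (d + e)^2 - 4
   d^2; then e^2 <= e makes the bound linear in [e]. *)
have mid y z e : Q y -> Q z -> 0 <= e -> e <= 1 -> `|x - y| <= d + e ->
    `|x - z| <= d + e -> `|y - z| ^+ 2 <= 4 * (2 * d + 1) * e.
  move=> Qy Qz e0 e1 xy xz.
  have h0 : 0 <= 2^-1 :> R by lra.
  have h1 : 2^-1 <= 1 :> R by lra.
  have /dle dm := convex_segment h0 h1 Qy Qz.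
  have := parallelogram (x - y) (x - z).
  have -> : x - y - (x - z) = z - y by rewrite opprB addrC addrA subrK.
  have -> : x - y + (x - z) = 2 *: (x - (y + 2^-1 *: (z - y))).
    rewrite scalerBr scalerDr scalerA divff// scale1r !scaler_nat !mulr2n.
    have -> : y + y + (z - y) = y + z by rewrite (addrC z) -addrA addNKr.
    by rewrite addrACA -opprD.
  rewrite normrZ ger0_norm// (distrC z) => E.
  have : d ^+ 2 <= `|x - (y + 2^-1 *: (z - y))| ^+ 2 by rewrite ler_sqr ?nnegrE.
  have : `|x - y| ^+ 2 <= (d + e) ^+ 2 by rewrite ler_sqr ?nnegrE ?addr_ge0.
  have : `|x - z| ^+ 2 <= (d + e) ^+ 2 by rewrite ler_sqr ?nnegrE ?addr_ge0.
  move: E.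
  have : e ^+ 2 <= e by rewrite expr2 ler_piMl.
  rewrite sqrrD exprMn => e2 E; rewrite mulr2n => h1' h2' h3'.
  nra.
have /choice[y yP] n : exists y, Q y /\ `|x - y| <= d + n.+1%:R^-1.
  have [|_ [y Qy <-] yd] := @inf_adherent _ D n.+1%:R^-1 _ D0; first by [].
  by exists y; split => //; exact: ltW.
have cy : cauchy (y @ \oo).
  apply: cauchy_exP => e e0.
  have [N _ Nd] : \forall n \near \oo, 4 * (2 * d + 1) * n.+1%:R^-1 < e ^+ 2.
    have c0 : 0 < 4 * (2 * d + 1) by lra.
    have ec0 : 0 < (4 * (2 * d + 1))^-1 * e ^+ 2 by rewrite mulr_gt0 ?invr_gt0 ?exprn_gt0.
    near=> n; rewrite -ltr_pdivlMl//.
    near: n; exact: (near_infty_natSinv_lt (PosNum ec0)).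
  exists (y N); exists N => // n /= Nn; rewrite -ball_normE /=.
  rewrite -ltr_sqr ?nnegrE// ?(ltW e0)//.
  apply: le_lt_trans (Nd N (leqnn N)).
  have [QN dN] := yP N; have [Qn dn] := yP n.
  apply: mid => //; first by rewrite invf_le1// ler1n.
  by apply: le_trans dn _; rewrite lerD2l lef_pV2 ?posrE// ler_nat.
have /cvg_ex[p yp] : cvg (y @ \oo) by exact/cauchy_cvgP.
exists p; split.
  apply: (closed_cvg Q closedQ _ p yp); apply: nearW => n; by have [] := yP n.
move=> z Qz; apply: le_trans (dle _ Qz).
apply/ler_addgt0Pr => e e0.
have e20 : 0 < e / 2 by rewrite divr_gt0.
near \oo => n.
have dn : n.+1%:R^-1 < e / 2 by near: n; exact: (near_infty_natSinv_lt (PosNum e20)).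
have ypn : `|p - y n| < e / 2 by near: n; exact: cvgr_dist_lt.
have [_ xyn] := yP n.
have -> : x - p = (x - y n) + (y n - p) by rewrite addrA subrK.
apply: (le_trans (ler_normD _ _)); rewrite [e]splitr addrA.
apply: lerD; last by rewrite distrC ltW.
by apply: (le_trans xyn); rewrite lerD2l ltW.
Unshelve. all: by end_near. Qed.

Lemma nearest_point_dot (x p q : H) :
  nearest_point Q x p -> Q q -> ip (x - p) (q - p) <= 0.
Proof.
move=> [Qp pmin] Qq; rewrite leNgt; apply/negP => c0.
set c := ip _ _ in c0; set n := `|q - p| ^+ 2.
have n0 : 0 <= n by rewrite exprn_ge0.
have cn0 : 0 < c + n by rewrite ltr_wpDr.
(* With t (c + n) = c one has t n < c, so a move by [t] towards [q] changes the squared distance to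
   [x] by t (t n - 2 c) < 0. *)
have [t [t0 t1 tcn]] : exists t, [/\ 0 < t, t <= 1 & t * (c + n) = c].
  exists (c / (c + n)); split; first by rewrite divr_gt0.
    by rewrite ler_pdivrMr// mul1r lerDl.
  by rewrite divfK// gt_eqF.
have /pmin := convex_segment (ltW t0) t1 Qp Qq.
rewrite -ler_sqr ?nnegrE// opprD addrA -!dot_norm.
have expand (v w : H) :
    ip (v - t *: w) (v - t *: w) = ip v v - 2 * t * ip v w + t ^+ 2 * ip w w.
  by rewrite !dotE (dotC w v); ring.
rewrite expand -/c [X in _ + _ * X]dot_norm -/n.
have := mulr_gt0 t0 c0; have : 0 < t * (t * n + (t * c - 2 * c)) -> False.
  by rewrite pmulr_rgt0//; move: tcn; rewrite mulrDr; nra.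
nra.
Qed.

End hilbert.

(** * Riesz representation and gradients *)

Lemma metric_projP (R : realType) (H : completeNormedModType R)
    (ip : {dot H for idfun}) (hilbertH : norm_from_dot ip)
    (Q : set H) (closedQ : closed Q) (convexQ : convex_set Q)
    (Q_neq0 : Q !=set0) (x : H) :
  nearest_point Q x (metric_proj Q x).
Proof.
have [p xp] := nearest_point_exists hilbertH closedQ convexQ x Q_neq0.
exact: (xgetI 0 xp).
Qed.

(** The point [p] of the hyperplane L = 1 nearest to the origin is orthogonal to the kernel of [L],
    so p / <p,p> represents [L]. *)
Lemma riesz_representation (R : realType) (H : completeNormedModType R)
    (ip : {dot H for idfun}) (hilbertH : norm_from_dot ip)
    (L : {linear H -> R}) : continuous L -> exists g, forall v, L v = ip g v.
Proof.
move=> cL; have [L0|/existsNP[w Lw]] := pselect (forall v, L v = 0).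
  by exists 0 => v; rewrite L0 (dotC ip) dot0r.
have {}Lw : L w != 0 by apply/eqP.
pose Q := [set v | L v = 1] : set H.
have cQ : closed Q.
  by apply: (@preimage_closed _ R^o L [set 1]) => [v _|]; [exact: cL|exact: closed_eq].
have vQ : convex_set Q.
  move=> u v t; rewrite !inE /Q /= => u1 v1.
  change (L (t%:num *: u + (1 - t%:num) *: v) = 1).
  by rewrite linearD !linearZ u1 v1 /= -mulrDl addrC subrK mulr1.
have Q0 : Q !=set0 by exists ((L w)^-1 *: w); rewrite /Q /= linearZ; exact: mulVf.
have [p p0] := nearest_point_exists hilbertH cQ vQ 0 Q0.
have Lp : L p = 1 by case: p0.
have pp0 : ip p p != 0.
  rewrite gt_eqF// neq0_dnorm_gt0//; apply: contra_eq_neq Lp => ->.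
  by rewrite linear0 eq_sym oner_eq0.
(* Both p + v and p - v stay in the hyperplane, and the variational inequality at each gives one
   sign. *)
have orth v : L v = 0 -> ip p v = 0.
  move=> Lv; apply/eqP; rewrite eq_le; apply/andP; split.
    have Qpv : Q (p - v) by rewrite /Q /= linearB /= Lv Lp subr0.
    have := nearest_point_dot hilbertH vQ p0 Qpv.
    by rewrite sub0r addrAC subrr sub0r dotNl dotNr opprK.
  have Qpv : Q (p + v) by rewrite /Q /= linearD /= Lv Lp addr0.
  have := nearest_point_dot hilbertH vQ p0 Qpv.
  by rewrite sub0r addrAC subrr add0r dotNl oppr_le0.
exists ((ip p p)^-1 *: p) => v.
have : ip p (v - L v *: p) = 0.
  apply: orth; rewrite linearB linearZ Lp; apply/eqP; rewrite subr_eq0 eq_sym.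
  by apply/eqP; exact: mulr1.
rewrite dotBr dotZr => /eqP; rewrite subr_eq0 => /eqP E.
by rewrite dotZl E mulrCA mulVf// mulr1.
Qed.

(** Riesz representation makes the set in [gradient] non-empty, which rules out the default value of
    [xget]. *)
Lemma gradientP (R : realType) (H : completeNormedModType R)
    (ip : {dot H for idfun}) (hilbertH : norm_from_dot ip) (f : H -> R) (x v : H) :
  differentiable f x -> 'd f x v = ip (gradient ip f x) v.
Proof.
move=> df; have [g gP] := riesz_representation hilbertH (diff_continuous df).
have : [set g | forall v, 'd f x v = ip g v] (gradient ip f x) by apply: (@xgetPex _ 0); exists g.
by apply.
Qed.

(** By convexity the difference quotient of [f] at [x] along y - x is at most f y - f x for each
    step in ]0, 1]; the step then tends to 0 from the right. *)
Lemma convex_gradient (R : realType) (H : completeNormedModType R)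
    (ip : {dot H for idfun}) (hilbertH : norm_from_dot ip) (f : H -> R)
    (x y : H) :
  convex_function setT f -> differentiable f x ->
  ip (gradient ip f x) (y - x) <= f y - f x.
Proof.
move=> cf df; rewrite -gradientP// -deriveE//.
have dv : derivable f x (y - x) by exact: diff_derivable.
have cvg_right : h^-1 *: (f (h *: (y - x) + x) - f x) @[h --> 0^'+] --> 'D_(y - x) f x.
  exact: cvg_dnbhs_at_right dv.
apply: (cvgr_to_le cvg_right); near=> h.
have h0 : 0 < h by near: h; exact: nbhs_right_gt.
have h1 : h <= 1 by near: h; exact: nbhs_right_le.
have inT (z : convex_lmodType H) : z \in [set: convex_lmodType H] by rewrite inE.
have fle : f (h *: y + (1 - h) *: x) <= h * f y + (1 - h) * f x.
  exact: cf (Itv01 (ltW h0) h1) y x (inT y) (inT x).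
have -> : h *: (y - x) + x = h *: y + (1 - h) *: x.
  by rewrite scalerBl scale1r scalerBr addrAC addrA.
rewrite -[_ *: _]/(h^-1 * _) ler_pdivrMl//; lra.
Unshelve. all: by end_near. Qed.

(** * Trajectories of the projected gradient flow *)

Lemma is_derive1P (R : realType) (V : normedModType R) (F : R -> V) (t : R)
    (d : V) :
  h^-1 *: (F (h + t) - F t) @[h --> 0^'] --> d <-> is_derive t 1 F d.
Proof.
have E : (fun h : R => h^-1 *: ((F \o shift t) (h *: 1) - F t)) =
         (fun h => h^-1 *: (F (h + t) - F t)).
  by apply/funext => h /=; rewrite /GRing.scale/= mulr1.
split=> [Fd|[Fd <-]].
  by apply: DeriveDef; [rewrite /derivable E; apply/cvg_ex; exists d |
    rewrite /derive E; exact/cvg_lim].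
by rewrite /derive E; rewrite /derivable E in Fd.
Qed.

Lemma is_derive_within_interior (R : realType) (V : normedModType R)
    (A : set R) (F : R -> V) (t : R) (d : V) :
  nbhs t A -> is_derivative_within A F t d -> is_derive t 1 F d.
Proof.
move=> At Fd; apply/is_derive1P/cvgrPdist_lt => e e0.
move/cvgrPdist_lt : Fd => /(_ e e0).
rewrite !near_withinE => Fd.
have {}Fd : \forall s \near t, s != t -> `|d - (s - t)^-1 *: (F s - F t)| < e.
  by near=> s => st; apply: (near Fd s) => //; near: s.
rewrite (near_shift 0 t) in Fd; near=> h => h0.
have : h + t != t -> `|d - (h + t - t)^-1 *: (F (h + t) - F t)| < e.
  by near: h; move: Fd; apply: filterS => h; rewrite /= subr0.
by rewrite addrK -subr_eq0 addrK; apply.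
Unshelve. all: by end_near. Qed.

Lemma is_derivative_within_continuous (R : realType) (V : normedModType R)
    (A : set R) (F : R -> V) (t : R) (d : V) :
  is_derivative_within A F t d -> F @ within A (nbhs t) --> F t.
Proof.
move=> Fd.
have st : (s - t) *: ((s - t)^-1 *: (F s - F t)) @[s --> within A t^'] --> (0 : V).
  rewrite -[X in _ --> X](scale0r d); apply: cvgZ Fd.
  rewrite -[X in _ --> X](subrr t); apply: cvgB; last exact: cvg_cst.
  by apply: cvg_within_filter; apply: cvg_within_filter; exact: cvg_id.
apply/cvgrPdist_lt => e e0; move/cvgrPdist_lt : st => /(_ e e0).
rewrite !near_withinE => st; near=> s => As.
have [->|snt] := eqVneq s t; first by rewrite subrr normr0.
have : s != t -> A s -> `|0 - (s - t) *: ((s - t)^-1 *: (F s - F t))| < e.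
  by near: s.
rewrite scalerA divff ?subr_eq0// scale1r sub0r normrN distrC.
by apply.
Unshelve. all: by end_near. Qed.

Lemma le_of_is_derive_le0 (R : realType) (F dF : R -> R) (a b : R) :
  a <= b -> {within `[a, b], continuous F} ->
  (forall t, a < t -> t < b -> is_derive t 1 F (dF t)) ->
  (forall t, a < t -> t < b -> dF t <= 0) -> F b <= F a.
Proof.
move=> ab cF FdF dF0.
apply: (@ler0_derive1_le_cc _ F a b) => //; rewrite ?in_itv/= ?lexx ?ab//.
  by move=> t; rewrite in_itv/= => /andP[at_ tb]; have [] := FdF t at_ tb.
move=> t; rewrite in_itv/= => /andP[at_ tb]; have [_ E] := FdF t at_ tb.
by rewrite derive1E E dF0.
Qed.

Lemma le_of_is_derive_le0_open (R : realType) (F dF : R -> R) (a b c : R) :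
  c < a -> a <= b ->
  (forall t, c < t -> is_derive t 1 F (dF t)) ->
  (forall t, a < t -> t < b -> dF t <= 0) -> F b <= F a.
Proof.
move=> ca ab FdF dF0; apply: (@le_of_is_derive_le0 _ _ dF) => //.
  apply: derivable_within_continuous => t; rewrite in_itv/= => /andP[at_ _].
  by have [] := FdF t (lt_le_trans ca at_).
by move=> t at_ _; apply: FdF; exact: lt_trans at_.
Qed.

(** * Differentiating inner products, squared distances and values of f *)

Section derivative_dot.
Context (R : realType) (H : completeNormedModType R) (ip : {dot H for idfun}).
Hypothesis hilbertH : norm_from_dot ip.

Lemma cvg_dot (T : Type) (F : set_system T) (FF : Filter F) (u : H)
    (v : T -> H) (l : H) :
  v @ F --> l -> ip u (v s) @[s --> F] --> ip u l.
Proof.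
move=> vl; apply/cvgrPdist_lt => e e0.
(* The [+ 1] covers the case u = 0. *)
have e1 : 0 < e / (`|u| + 1) by rewrite divr_gt0// ltr_wpDl.
near=> s; rewrite -dotBr; apply: (le_lt_trans (cauchy_schwarz hilbertH _ _)).
have : `|l - v s| < e / (`|u| + 1) by near: s; exact: cvgr_dist_lt.
rewrite ltr_pdivlMr ?ltr_wpDl//; apply: le_lt_trans.
by rewrite mulrC ler_wpM2l// lerDl.
Unshelve. all: by end_near. Qed.

Lemma is_derive_dot (u : H) (x : R -> H) (t : R) (d : H) :
  is_derive t 1 x d -> is_derive t 1 (fun s => ip u (x s)) (ip u d).
Proof.
move=> /is_derive1P xd; apply/is_derive1P.
under eq_fun do rewrite -dotBr -[_ *: ip _ _]/(_ * ip _ _) -dotZr.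
exact: cvg_dot.
Qed.

Lemma is_derive_half_dist (q : H) (x : R -> H) (t : R) (d : H) :
  is_derive t 1 x d ->
  is_derive t 1 (fun s => 2^-1 * `|x s - q| ^+ 2) (ip d (x t - q)).
Proof.
move=> /is_derive1P xd; apply/is_derive1P.
(* With w the difference quotient of [x], that of the half squared distance is <x t - q, w> + (h /
   2) |w|^2, whose last term vanishes in the limit. *)
have E : \forall h \near 0^',
   ip (x t - q) (h^-1 *: (x (h + t) - x t)) +
    h / 2 * `|h^-1 *: (x (h + t) - x t)| ^+ 2 =
   h^-1 *: (2^-1 * `|x (h + t) - q| ^+ 2 - 2^-1 * `|x t - q| ^+ 2).
  near=> h; have h0 : h != 0 by near: h; exact: nbhs_dnbhs_neq.
  set y := x (h + t); set z := x t; rewrite -[RHS]/(_ * _).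
  have -> : y - q = (z - q) + (y - z) by rewrite [RHS]addrC addrA subrK.
  move: (z - q) (y - z) => a b.
  rewrite -!(dot_norm hilbertH) !(dotZr, dotZl) !(dotDl, dotDr) (dotC ip b a).
  by field.
apply: cvg_trans (near_eq_cvg E) _.
have -> : ip d (x t - q) = ip (x t - q) d + 0 / 2 * `|d| ^+ 2.
  by rewrite !mul0r addr0 dotC.
apply: cvgD; first exact: cvg_dot.
apply: cvgM; last by rewrite expr2; apply: cvgM; exact: cvg_norm.
apply: cvgM; last exact: cvg_cst.
by apply: cvg_within_filter; exact: cvg_id.
Unshelve. all: by end_near. Qed.

Lemma is_derive_comp_gradient (f : H -> R) (x : R -> H) (t : R) (d : H) :
  differentiable f (x t) -> is_derive t 1 x d ->
  is_derive t 1 (f \o x) (ip (gradient ip f (x t)) d).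
Proof.
move=> df [/derivable1_diffP dx xd].
apply: DeriveDef; first by apply/derivable1_diffP; exact: differentiable_comp.
rewrite deriveE; last exact: differentiable_comp.
by rewrite diff_comp//= -(gradientP hilbertH)// -xd deriveE.
Qed.

End derivative_dot.

(** * Differential inequalities along a trajectory *)

Section flow.
Context (R : realType) (H : completeNormedModType R) (ip : {dot H for idfun}).
Hypothesis hilbertH : norm_from_dot ip.
Variables (Q : set H) (lambda : R -> R) (f : H -> R).
Hypotheses (closedQ : closed Q) (convexQ : convex_set Q) (Q_neq0 : Q !=set0).
Variables (x dx : R -> H).
Hypothesis xdx : forall t : R, 0 <= t -> is_derivative_within `[0, +oo[ x t (dx t).

Lemma is_derive_trajectory (t : R) : 0 < t -> is_derive t 1 x (dx t).
Proof.
move=> t0; apply: is_derive_within_interior (xdx (ltW t0)).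
near=> s; rewrite /= in_itv/= andbT ltW//; near: s; exact: lt_nbhsr.
Unshelve. all: by end_near. Qed.

(* With p = P_Q(x(T)) and n = x(T) - p, the half-space <n, y - p> <= 0 contains
   Q, so exp(t) <n, x(t) - p> is nonincreasing; at t = T it is exp(T) |n|^2. *)
Lemma trajectory_in (Qx0 : Q (x 0)) (Qdx : forall t : R, 0 <= t -> Q (dx t + x t))
    (T : R) :
  0 <= T -> Q (x T).
Proof.
rewrite le_eqVlt => /predU1P[<-//|T0].
have xTp := metric_projP hilbertH closedQ convexQ Q_neq0 (x T).
set p := metric_proj Q (x T) in xTp *; have [Qp _] := xTp.
pose n := x T - p; suff : n = 0 by move/eqP; rewrite subr_eq0 => /eqP ->.
have nQ q : Q q -> ip n (q - p) <= 0 by exact: nearest_point_dot xTp.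
pose F := expR * (fun t => ip n (x t - p)).
have FT0 : F T <= F 0.
  apply: (@le_of_is_derive_le0 _ F (fun t => expR t * ip n (dx t + x t - p))).
  - exact: ltW.
  (* At time 0 only a one-sided derivative is given, so continuity is proved relative to the
     half-line. *)
  - have cF : {within `[0, +oo[, continuous F}; last first.
      apply: continuous_subspaceW cF => t /=; rewrite !in_itv/=.
      by case/andP => ->.
    apply/subspace_continuousP => t /=; rewrite in_itv/= andbT => t0.
    apply: cvgM; first by apply: cvg_within_filter; exact: continuous_expR.
    apply: (@cvg_dot _ _ _ hilbertH); apply: cvgB; last exact: cvg_cst.
    exact: is_derivative_within_continuous (xdx t0).
  - move=> t t0 _; have dt := is_derive_trajectory t0.
    have d1 : is_derive t 1 (fun s => ip n (x s - p)) (ip n (dx t)).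
      apply: (is_derive_dot hilbertH); rewrite -[dx t]subr0.
      exact: (is_deriveB dt (is_derive_cst p t 1)).
    apply: is_derive_eq.
    by rewrite -addrA [in RHS]dotDr mulrDr; congr (_ + _); exact: mulrC.
  - move=> t t0 _; rewrite pmulr_rle0 ?expR_gt0//.
    by apply: nQ; apply: Qdx; exact: ltW.
have F0 : F 0 <= 0 by rewrite /F mulrfctE expR0 mul1r nQ.
have := le_trans FT0 F0; rewrite /F mulrfctE pmulr_rle0 ?expR_gt0// -/n.
rewrite (dot_norm hilbertH) => n0; apply/eqP; rewrite -normr_eq0 -sqrf_eq0.
by rewrite eq_le n0 exprn_ge0.
Qed.

Hypothesis (diff_f : forall y, differentiable f y) (convexf : convex_function setT f).
Hypothesis trajQ : forall t : R, 0 <= t -> Q (x t).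
Hypothesis lambda_gt0 : forall t : R, 0 <= t -> 0 < lambda t.
Variable M : R.
Hypothesis lambdaM : forall t : R, 0 <= t -> lambda t <= M.
Hypothesis ode : forall t : R, 0 <= t ->
  dx t + x t = metric_proj Q (x t - lambda t *: gradient ip f (x t)).

(** The projected point is x + x', so the residual in the projection inequality is -(x' + lambda
    grad f(x)). *)
Lemma trajectory_variational (q : H) (t : R) : 0 <= t -> Q q ->
  ip (dx t) (x t - q) + ip (dx t) (dx t) +
  lambda t * (ip (gradient ip f (x t)) (x t - q) + ip (gradient ip f (x t)) (dx t))
  <= 0.
Proof.
move=> t0 Qq; set g := gradient ip f (x t).
have := nearest_point_dot hilbertH convexQ
  (metric_projP hilbertH closedQ convexQ Q_neq0 (x t - lambda t *: g)) Qq.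
rewrite -ode//; congr (_ <= _).
by rewrite !dotE; ring.
Qed.

Lemma derive_value_le (t : R) : 0 <= t ->
  lambda t * ip (gradient ip f (x t)) (dx t) <= - ip (dx t) (dx t).
Proof.
move=> t0; have := trajectory_variational t0 (trajQ t0).
rewrite subrr !dot0r; lra.
Qed.

Lemma derive_value_le0 (t : R) : 0 <= t -> ip (gradient ip f (x t)) (dx t) <= 0.
Proof.
move=> t0; rewrite -(pmulr_rle0 _ (lambda_gt0 t0)).
by apply: (le_trans (derive_value_le t0)); rewrite oppr_le0 dot_ge0.
Qed.

Lemma is_derive_value (t : R) : 0 < t ->
  is_derive t 1 (f \o x) (ip (gradient ip f (x t)) (dx t)).
Proof. by move=> t0; apply: is_derive_comp_gradient => //; exact: is_derive_trajectory. Qed.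

Lemma value_nonincreasing (s t : R) : 0 < s -> s <= t -> f (x t) <= f (x s).
Proof.
move=> s0 st.
apply: (le_of_is_derive_le0_open s0 st is_derive_value) => r sr _.
by apply: derive_value_le0; rewrite ltW// (lt_trans s0).
Qed.

(** The constant [M] in place of lambda(t) keeps lambda' out of the derivative. *)
Definition energy (q : H) (t : R) : R := 2^-1 * `|x t - q| ^+ 2 + M * f (x t).

(** At r < t convexity and the decrease of the value give <grad f(x r), x r - q> >= f(x r) - f q >=
    c, and (M - lambda) phi' <= 0; adding these to the variational inequality makes the derivative
    nonpositive. The case c = 0 gives monotonicity of the energy, and c > 0 bounds the integral of
    [lambda]. *)
Lemma energy_decrease (q : H) (c s t : R) (L : R -> R) :
  0 < s -> s <= t -> Q q -> 0 <= c -> c <= f (x t) - f q ->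
  (forall r : R, 0 < r -> is_derive r 1 L (c * lambda r)) ->
  energy q t + L t <= energy q s + L s.
Proof.
move=> s0 st Qq c0 cf dL.
pose phi' r := ip (gradient ip f (x r)) (dx r).
pose E : R -> R := (fun r => 2^-1 * `|x r - q| ^+ 2) + (M *: (f \o x) + L).
suff : E t <= E s by rewrite /energy -!addrA.
pose dE r := ip (dx r) (x r - q) + (M * phi' r + c * lambda r).
have EdE (r : R) : 0 < r -> is_derive r 1 E (dE r).
  move=> r0; have dr := is_derive_trajectory r0.
  have d1 := is_derive_half_dist hilbertH q dr.
  have d2 := is_derive_value r0; have d3 := dL r r0.
  exact: is_deriveD.
suff dE0 (r : R) : s < r -> r < t -> dE r <= 0.
  exact: (le_of_is_derive_le0_open s0 st EdE dE0).
move=> sr rt; rewrite /dE; have r0 : 0 < r by exact: lt_trans sr.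
have vi := trajectory_variational (ltW r0) Qq.
have := convex_gradient hilbertH q convexf (diff_f (x r)).
rewrite -[q - x r]opprB dotNr => cg.
have phi0 := derive_value_le0 (ltW r0); rewrite -/(phi' r) in vi phi0.
have lM : (M - lambda r) * phi' r <= 0.
  by rewrite mulr_ge0_le0// subr_ge0 lambdaM// ltW.
have fc : c <= f (x r) - f q.
  by apply: (le_trans cf); rewrite lerB// value_nonincreasing// ltW.
have lc : 0 <= lambda r * (ip (gradient ip f (x r)) (x r - q) - c).
  apply: mulr_ge0; first by rewrite ltW// lambda_gt0// ltW.
  by move: cg fc; lra.
have := dot_ge0 ip (dx r); move: vi lM lc; rewrite mulrDr mulrBl mulrBr.
rewrite [c * _]mulrC; move: (phi' r) => p; lra.
Qed.

Lemma energy_nonincreasing (q : H) (s t : R) : 0 < s -> s <= t -> Q q ->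
  f q <= f (x t) -> energy q t <= energy q s.
Proof.
move=> s0 st Qq fq.
have := @energy_decrease q 0 s t (cst 0) s0 st Qq (lexx 0).
rewrite subr_ge0 !addr0; apply => // r r0.
by rewrite mul0r; exact: is_derive_cst.
Qed.

(** For q = - x t the distances to [q] are |x s + x t| and 2 |x t|, and the parallelogram identity
    turns the first into |x s - x t|. The sign of M (f (x s) - f (x t)) absorbs the mismatch in the
    value terms. *)
Lemma dist_le_of_symmetric (s t : R) :
  (forall y, Q y -> Q (- y) /\ f (- y) = f y) -> 0 < s -> s <= t ->
  `|x s - x t| ^+ 2 <= 4 * (energy 0 s - energy 0 t).
Proof.
move=> symQ s0 st; have t0 : 0 <= t by rewrite ltW// (lt_le_trans s0).
have [Qxt fxt] := symQ _ (trajQ t0).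
have := energy_nonincreasing s0 st Qxt; rewrite fxt lexx => /(_ isT).
have := parallelogram hilbertH (x s) (x t).
have xx : x t + x t = 2 *: x t by rewrite scaler_nat mulr2n.
have : 0 <= M * (f (x s) - f (x t)).
  rewrite mulr_ge0 ?subr_ge0 ?value_nonincreasing//.
  exact: le_trans (ltW (lambda_gt0 t0)) (lambdaM t0).
rewrite /energy !opprK !subr0 xx normrZ exprMn ger0_norm//; lra.
Qed.

Lemma dist_le_of_interior (z : H) (r s t : R) : 0 < r ->
  (forall y, `|z - y| <= r -> argmin Q f y) -> 0 < s -> s <= t ->
  r * `|x s - x t| <= energy z s - energy z t.
Proof.
move=> r0 zr s0 st; have t0 : 0 <= t by rewrite ltW// (lt_le_trans s0).
(* If both points agree there is no direction to normalize, and monotonicity of the energy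
   suffices. *)
have [xst|xst] := eqVneq (x s) (x t).
  have [|Qz zmin] := zr z; first by rewrite subrr normr0 ltW.
  rewrite xst subrr normr0 mulr0 subr_ge0; apply: energy_nonincreasing => //.
  exact/zmin/trajQ.
have d0 : 0 < `|x s - x t| by rewrite normr_gt0 subr_eq0.
set d := `|x s - x t| in d0 *.
(* The point q = z - u is on the sphere of radius [r] around [z], opposite to the displacement. The
   cross term <u, x - z> grows by exactly r d between [s] and [t]. *)
pose u := (r / d) *: (x t - x s).
have nu : `|u| = r by rewrite normrZ distrC ger0_norm ?divr_ge0 ?ltW// divfK// gt_eqF.
have [|Qz zmin] := zr (z - u); first by rewrite opprB addrC subrK nu.
have := energy_nonincreasing s0 st Qz (zmin _ (trajQ t0)).
have expand (v : H) : `|v - (z - u)| ^+ 2 = `|v - z| ^+ 2 + 2 * ip u (v - z) + r ^+ 2.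
  have -> : v - (z - u) = (v - z) + u by rewrite opprB addrCA addrC.
  by rewrite (normD_sqr hilbertH) nu.
rewrite /energy !expand.
have : ip u (x t - z) - ip u (x s - z) = r * d.
  rewrite -dotBr opprB addrA subrK /u dotZl (dot_norm hilbertH) distrC -/d.
  by field; rewrite gt_eqF.
lra.
Qed.

End flow.

(** * Limits and integrals at infinity *)

Lemma cvg_of_decrease (R : realType) (H : completeNormedModType R) (x : R -> H)
    (h : R -> R) (m : R) :
  (forall t, 0 < t -> m <= h t) ->
  (forall e : R, 0 < e -> exists2 d : R, 0 < d & forall s t : R,
    0 < s -> s <= t -> h s - h t < d -> `|x s - x t| < e) ->
  cvg (x t @[t --> +oo]).
Proof.
move=> hm hx; apply/cauchy_cvgP/cauchy_exP => e e0.
have [d d0 xd] := hx _ e0.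
pose D := [set h t | t in `]0, +oo[].
have D0 : has_inf D.
  split; first by exists (h 1), 1 => //=; rewrite in_itv/= ltr01.
  by exists m => _ [t t0 <-]; apply: hm; move: t0; rewrite /= in_itv/= andbT.
(* At this time [h] is within [d] of its infimum, so it drops by less than [d] afterwards and [x]
   stays within [e] of [x s]. *)
have [_ [s s0 <-] hs] := inf_adherent d0 D0.
have {}s0 : 0 < s by move: s0; rewrite /= in_itv/= andbT.
exists (x s); change (\forall t \near +oo, ball (x s) e (x t)).
near=> t; rewrite -ball_normE/=; apply: xd => //.
rewrite ltrBlDl; apply: (lt_le_trans hs); rewrite addrC [leRHS]addrC lerD2l.
apply: ge_inf; first by case: D0.
exists t => //=; rewrite in_itv/= andbT.
by near: t; apply: nbhs_pinfty_gt; rewrite num_real.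
Unshelve. all: by end_near. Qed.

(** The primitive is the integral from 0, and monotone convergence along [[0, n + 1]] passes its
    bound to the half-line. In the theorem a bounded primitive contradicts the divergence of the
    integral of [lambda]. *)
Lemma integral_le_of_primitive_le (R : realType) (g : R -> R) :
  (forall T, 0 <= T -> {within `[0, T], continuous g}) ->
  (forall t, 0 <= t -> 0 <= g t) ->
  exists2 L : R -> R, forall t : R, 0 < t -> is_derive t 1 L (g t) &
    forall B : R, (forall t, 1 <= t -> L t <= B) ->
      (\int[lebesgue_measure]_(t in `[0%R, +oo[) (g t)%:E <= B%:E)%E.
Proof.
move=> cg g0.
have ig T : 0 <= T -> (@lebesgue_measure R).-integrable `[0, T]%classic (EFin \o g).
  by move=> T0; apply: continuous_compact_integrable (cg _ T0); exact: segment_compact.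
pose L t := (\int[lebesgue_measure]_(s in `[0, t]) g s)%R.
exists L => [t t0|B LB].
  (* The margin up to [t + 1] makes [t] an interior point. *)
  have tt : t < t + 1 by rewrite ltrDl.
  have t10 : 0 < t + 1 by rewrite addr_gt0.
  have ct : {for t, continuous g}.
    apply: (within_continuous_continuous t10 (cg _ (ltW t10))).
    by rewrite in_itv/= t0.
  have [dL Lg] := continuous_FTC1_closed tt (ig _ (ltW t10)) t0 ct.
  by rewrite derive1E in Lg; exact: DeriveDef dL Lg.
(* The right ends start at 1, where the bound on [L] begins. *)
pose F n : set (measurableTypeR R) := `[0, n.+1%:R]%classic.
have FE : \bigcup_n F n = `[0, +oo[%classic.
  apply/seteqP; split=> t; rewrite /F /=.
    by move=> [n _ /=]; rewrite !in_itv/= andbT => /andP[].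
  rewrite in_itv/= andbT => t0; exists (Num.bound t) => //=.
  rewrite in_itv/= t0/= ltW//; apply: (lt_trans (archi_boundP t0)).
  by rewrite ltr_nat.
have ndF : nondecreasing_seq F.
  move=> n k nk; apply/subsetPset => t; rewrite /F /= !in_itv/= => /andP[-> tn].
  by rewrite (le_trans tn)// ler_nat.
have mF n : measurable (F n) by exact: (@measurable_itv R `[0, n.+1%:R]).
have mg n : measurable_fun (F n) (EFin \o g).
  exact: (measurable_int _ (ig _ (ler0n _ _))).
have gF n t : F n t -> (0 <= (EFin \o g) t)%E.
  by rewrite /F /= in_itv/= lee_fin => /andP[t0 _]; exact: g0.
rewrite -FE; apply: (cvge_to_le (@ge0_nondecreasing_set_cvg_integral _ _ R F _
  lebesgue_measure ndF mF mg gF)); apply: nearW => n.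
have fin : (\int[lebesgue_measure]_(t in F n) (EFin \o g) t)%E \is a fin_num.
  by apply: integrable_fin_num => //; exact: ig.
rewrite -(fineK fin) lee_fin; apply: LB; exact: ler1n.
Qed.


(** * Convergence to a minimizer *)

Theorem theorem1p2 (R : realType) (H : completeNormedModType R)
    (ip : {dot H for idfun}) (hilbertH : norm_from_dot ip)
    (Q : set H) (closedQ : closed Q) (convexQ : convex_set Q)
    (Q_neq0 : Q !=set0)
    (lambda : R -> R)
    (lambda_gt0 : forall t : R, 0 <= t -> 0 < lambda t)
    (lambda_ac : forall T : R, 0 <= T -> absolutely_continuous_on 0 T lambda)
    (f : H -> R) (C1f : C1_function ip f)
    (convexf : convex_function setT f)
    (lipf : locally_lipschitz (gradient ip f))
    (argmin_neq0 : argmin Q f !=set0)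
    (int_lambda : (\int[lebesgue_measure]_(t in `[0%R, +oo[) (lambda t)%:E
                   = +oo)%E)
    (int_dlambda : (\int[lebesgue_measure]_(t in `[0%R, +oo[)
                      (`|derive1 lambda t|)%:E < +oo)%E)
    (hyp12 : (forall x, Q x -> Q (- x) /\ f (- x) = f x) \/
             (argmin Q f)° !=set0)
    (x0 : H) (Qx0 : Q x0)
    (x : R -> H) (solx : C1_solution ip Q lambda f x0 x) :
  exists2 xstar : H, argmin Q f xstar & x t @[t --> +oo%R] --> xstar.

Proof.
have [x00 [dx [_ xdx ode]]] := solx.
have [diff_f _] := C1f.
have [M lambdaM] := absolutely_continuous_bounded lambda_ac int_dlambda.
have clambda T : 0 <= T -> {within `[0, T], continuous lambda}.
  by move=> T0; apply: absolutely_continuous_on_continuous; exact: lambda_ac.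
have [L dL Lub] := integral_le_of_primitive_le clambda (fun t t0 => ltW (lambda_gt0 t t0)).
have trajQ t : 0 <= t -> Q (x t).
  apply: (trajectory_in hilbertH closedQ convexQ Q_neq0 xdx); first by rewrite x00.
  by move=> s s0; rewrite ode//; case: (metric_projP hilbertH closedQ convexQ Q_neq0
    (x s - lambda s *: gradient ip f (x s))).
have M0 : 0 <= M by apply: le_trans (lambdaM _ (lexx 0)); rewrite ltW// lambda_gt0.
have [z [Qz zmin]] := argmin_neq0.
(* A lower bound common to all energies, as the Cauchy criterion requires. *)
have energy_ge q t : 0 < t -> M * f z <= energy f x M q t.
  move=> t0; rewrite /energy -[leLHS]add0r lerD ?mulr_ge0//.
  by apply: ler_wpM2l => //; apply: zmin; apply: trajQ; exact: ltW.
have cx : cvg (x t @[t --> +oo]).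
  case: hyp12 => [symQ|[w /nbhs_ballP[r /= r0 wr]]].
    apply: (cvg_of_decrease (energy_ge 0)) => e e0.
    exists (e ^+ 2 / 4); first by rewrite divr_gt0 ?exprn_gt0.
    move=> s t s0 st st4; rewrite -ltr_sqr ?nnegrE ?(ltW e0)//.
    apply: le_lt_trans (dist_le_of_symmetric hilbertH closedQ convexQ Q_neq0 xdx
      diff_f convexf trajQ lambda_gt0 lambdaM ode symQ s0 st) _.
    by rewrite mulrC -ltr_pdivlMr.
  (* Half the radius puts a closed ball inside the given open ball. *)
  have r20 : 0 < r / 2 by rewrite divr_gt0.
  have wr2 y : `|w - y| <= r / 2 -> argmin Q f y.
    move=> wy; apply: wr; rewrite -ball_normE /=; apply: (le_lt_trans wy).
    by rewrite ltr_pdivrMr// mulr_natr mulr2n ltrDl.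
  apply: (cvg_of_decrease (energy_ge w)) => e e0.
  exists (r / 2 * e); first by rewrite mulr_gt0.
  move=> s t s0 st ste; rewrite -(ltr_pM2l r20); apply: le_lt_trans ste.
  exact: (dist_le_of_interior hilbertH closedQ convexQ Q_neq0 xdx
      diff_f convexf trajQ lambda_gt0 lambdaM ode r20 wr2 s0 st).
have /cvg_ex[xs xxs] := cx.
exists xs => //; split.
  apply: (closed_cvg Q closedQ _ xs xxs); near=> t; apply: trajQ.
  by near: t; apply: nbhs_pinfty_ge; rewrite num_real.
suff fxs : f xs <= f z by move=> y Qy; apply: (le_trans fxs); exact: zmin.
have ffxs : f (x t) @[t --> +oo] --> f xs.
  by apply: continuous_cvg => //; exact: differentiable_continuous.
(* The value is nonincreasing, so it never falls below its limit. *)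
have fxs_le t : 0 < t -> f xs <= f (x t).
  move=> t0; apply: (cvgr_to_le ffxs); near=> s.
  apply: (value_nonincreasing hilbertH closedQ convexQ Q_neq0 xdx diff_f trajQ
    lambda_gt0 ode t0).
  by near: s; apply: nbhs_pinfty_ge; rewrite num_real.
rewrite leNgt; apply/negP => zxs.
pose c := f xs - f z; have c0 : 0 < c by rewrite subr_gt0.
(* Solving the energy inequality between times 1 and [t], with q = z, for [L t], and bounding the
   energy at [t] below by [M * f z]. *)
pose B := (energy f x M z 1 + c * L 1 - M * f z) / c.
have /Lub : forall t, 1 <= t -> L t <= B.
  move=> t t1; rewrite /B ler_pdivlMr// mulrC lerBrDl.
  have t0 : 0 < t by exact: lt_le_trans t1.
  have cf : c <= f (x t) - f z by rewrite lerB// fxs_le.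
  have dcL (r : R) : 0 < r -> is_derive r 1 (c *: L) (c * lambda r).
    by move=> r0; have dr := dL r r0; exact: is_deriveZ.
  have := energy_decrease hilbertH closedQ convexQ Q_neq0 xdx diff_f convexf trajQ
    lambda_gt0 lambdaM ode ltr01 t1 Qz (ltW c0) cf dcL.
  apply: le_trans; rewrite lerD// energy_ge//.
by rewrite int_lambda.
Unshelve. all: by end_near. Qed.
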